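(* Let $D$ be an integral domain which is not a field and $\star$ a semistar operation on $D$. The following are equivalent: (1) $D$ is a $\star$-Dedekind domain ($\star$-DD). (2) For each nonzero ideal $I$ of $D$ and for each $a\in I$, $a\neq 0$, there exists $b\in I^{\tilde\star}$ such that $I^{\tilde\star}=((a,b)D)^{\tilde\star}$.
   Context: Let $D$ be an integral domain with quotient field $K$. $\overline{\boldsymbol F}(D)$ denotes the set of all nonzero $D$-submodules of $K$, and $\boldsymbol f(D)$ the set of nonzero finitely generated $D$-submodules of $K$. A semistar operation on $D$ is a map $\star:\overline{\boldsymbol F}(D)\to\overline{\boldsymbol F}(D)$, $E\mapsto E^\star$, such that for all $0\neq x\in K$ and $E,F\in\overline{\boldsymbol F}(D)$: $(xE)^\star=xE^\star$; $E\subseteq F$ implies $E^\star\subseteq F^\star$; $E\subseteq E^\star$ and $(E^\star)^\star=E^\star$. The semistar operation $\star_f$ is defined by $E^{\star_f}:=\bigcup\{F^\star : F\in\boldsymbol f(D),\ F\subseteq E\}$. A quasi-$\star$-ideal of $D$ is a nonzero ideal $I$ of $D$ with $I=I^\star\cap D$. $\mathcal{M}(\star_f)$ is the set of quasi-$\star_f$-maximal ideals, i.e. the maximal elements of the set of proper quasi-$\star_f$-ideals of $D$ (these are prime). The semistar operation $\tilde\star$ is defined by $E^{\tilde\star}:=\bigcap\{ED_Q : Q\in\mathcal{M}(\star_f)\}$ (the empty intersection being $K$). $D$ is $\star$-Noetherian if it has the ascending chain condition on quasi-$\star$-ideals. A nonzero ideal $I$ is $\star$-invertible if $(II^{-1})^\star=D^\star$,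 where $I^{-1}=\{z\in K: zI\subseteq D\}$. $D$ is a P$\star$MD if each nonzero finitely generated ideal of $D$ is $\star_f$-invertible. $D$ is a $\star$-Dedekind domain ($\star$-DD) if it is $\star$-Noetherian and a P$\star$MD. Here $(a,b)D$ denotes the $D$-submodule $aD+bD$ of $K$. *)

(* Defs.v *)
From HB Require Import structures.
From mathcomp Require Import all_boot all_order all_algebra.
From mathcomp Require Import all_classical.
Set Implicit Arguments.
Unset Strict Implicit.
Unset Printing Implicit Defensive.
Import GRing.Theory.
Local Open Scope ring_scope.
Local Open Scope classical_set_scope.

Local Notation "x %:F" := (tofrac x).

(* D is identified with its image in its quotient field {fraction D}, so the
   ideals of D are the D-submodules of {fraction D} contained in [domain D]. *)
Definition domain (D : idomainType) : set {fraction D} :=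
  range (fun d : D => d%:F).
Arguments domain D : clear implicits.

Definition submodule (D : idomainType) (E : set {fraction D}) : Prop :=
  [/\ E 0, (forall x y, E x -> E y -> E (x + y))
    & forall (d : D) x, E x -> E (d%:F * x)].

Definition nonzero_submodule (D : idomainType) (E : set {fraction D}) : Prop :=
  submodule E /\ exists2 x, E x & x != 0.

Definition generated (D : idomainType) (s : seq {fraction D}) :
    set {fraction D} :=
  [set x | exists c : 'I_(size s) -> D, x = \sum_(i < size s) (c i)%:F * s`_i].

Definition nonzero_fg_submodule (D : idomainType) (F : set {fraction D}) : Prop :=
  nonzero_submodule F /\ exists s, F = generated s.

Definition nonzero_ideal (D : idomainType) (I : set {fraction D}) : Prop :=
  nonzero_submodule I /\ I `<=` domain D.

Definition scale (D : idomainType) (x : {fraction D}) (E : set {fraction D}) :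
    set {fraction D} :=
  [set x * y | y in E].

Definition mul_submodule (D : idomainType) (E F : set {fraction D}) :
    set {fraction D} :=
  [set x | exists n (e f : 'I_n -> {fraction D}),
    [/\ forall i, E (e i), forall i, F (f i) & x = \sum_(i < n) e i * f i]].

(* A semistar operation is only defined on the nonzero D-submodules of
   {fraction D}; the values of [star_fun] elsewhere are unconstrained. *)
Record semistar (D : idomainType) := Semistar {
  star_fun :> set {fraction D} -> set {fraction D};
  star_submodule : forall E, nonzero_submodule E ->
    nonzero_submodule (star_fun E);
  star_scale : forall x E, x != 0 -> nonzero_submodule E ->
    star_fun (scale x E) = scale x (star_fun E);
  star_mono : forall E F, nonzero_submodule E -> nonzero_submodule F ->
    E `<=` F -> star_fun E `<=` star_fun F;
  star_ext : forall E, nonzero_submodule E -> E `<=` star_fun E;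
  star_idem : forall E, nonzero_submodule E ->
    star_fun (star_fun E) = star_fun E }.

Definition finite_type (D : idomainType)
    (star : set {fraction D} -> set {fraction D}) (E : set {fraction D}) :
    set {fraction D} :=
  \bigcup_(F in [set F | nonzero_fg_submodule F /\ F `<=` E]) star F.

Definition quasi_ideal (D : idomainType)
    (star : set {fraction D} -> set {fraction D}) (I : set {fraction D}) : Prop :=
  nonzero_ideal I /\ I = star I `&` domain D.

Definition quasi_maximal (D : idomainType)
    (star : set {fraction D} -> set {fraction D}) (Q : set {fraction D}) : Prop :=
  [/\ quasi_ideal star Q, Q <> domain D &
    forall J, quasi_ideal star J -> J <> domain D -> Q `<=` J -> J = Q].

Definition localization (D : idomainType) (Q : set {fraction D}) :
    set {fraction D} :=
  [set z | exists x s : D, ~ Q s%:F /\ z = x%:F / s%:F].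

(* \bigcap over an empty family is the whole of {fraction D} *)
Definition tilde (D : idomainType)
    (star : set {fraction D} -> set {fraction D}) (E : set {fraction D}) :
    set {fraction D} :=
  \bigcap_(Q in quasi_maximal (finite_type star))
    mul_submodule E (localization Q).

Definition star_noetherian (D : idomainType)
    (star : set {fraction D} -> set {fraction D}) : Prop :=
  forall I : nat -> set {fraction D},
    (forall n, quasi_ideal star (I n)) ->
    (forall n, I n `<=` I n.+1) ->
    exists N, forall n, (N <= n)%N -> I n = I N.

Definition inverse (D : idomainType) (I : set {fraction D}) :
    set {fraction D} :=
  [set z | scale z I `<=` domain D].

Definition star_invertible (D : idomainType)
    (star : set {fraction D} -> set {fraction D}) (I : set {fraction D}) : Prop :=
  star (mul_submodule I (inverse I)) = star (domain D).

Definition star_prufer (D : idomainType)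
    (star : set {fraction D} -> set {fraction D}) : Prop :=
  forall I, nonzero_ideal I -> nonzero_fg_submodule I ->
    star_invertible (finite_type star) I.

Definition star_dedekind (D : idomainType)
    (star : set {fraction D} -> set {fraction D}) : Prop :=
  star_noetherian star /\ star_prufer star.

(* Main.v *)
(* Only the localizations D_Q at the quasi-star_f-maximal ideals Q matter.

   (2) => (1): applying (2) to I with first generator a = q a', q in Q, and
   arguing as in Nakayama's lemma, I D_Q is principal for every I and Q. A
   finitely generated I then has I I^-1 contained in no Q, so it is
   star_f-invertible. For a chain of quasi-star-ideals with union U, the
   two generators of U^tilde are already in I_N^tilde for some N, because tilde
   is of finite type, and I_N^tilde lies in I_N^star.

   (1) => (2): the Prufer hypothesis gives F^star /\ D <= F D_Q for F finitely
   generated, and the chain condition extends this to all ideals, so each I D_Q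
   is principal. Choose b in I with (a,b)^tilde /\ D maximal. If
   I D_Q = c D_Q is larger than (a,b) D_Q for some Q, take t outside Q which
   lies in a D_Q' for all Q' <> Q: replacing b by b + t c changes nothing at the
   other Q' and makes the ideal strictly larger at Q, a contradiction. No
   finite-character property is needed. *)
Require Import Defs.
From HB Require Import structures.
From mathcomp Require Import all_boot all_order all_algebra.
From mathcomp Require Import all_classical.
From mathcomp Require Import ring.
Import GRing.Theory.
Local Open Scope ring_scope.
Local Open Scope classical_set_scope.

Set Implicit Arguments.
Unset Strict Implicit.
Unset Printing Implicit Defensive.

Local Notation "x %:F" := (tofrac x).

(** * Arithmetic of [D]-submodules of the quotient field *)

Section Submodules.
Variable D : idomainType.
Local Notation K := {fraction D}.
Implicit Types (E F I : set K) (d : D) (x y : K) (s : seq K).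

Lemma fraction_numden x : exists2 d : D, d != 0 & domain D (d%:F * x).
Proof.
elim/quotW: x => r; exists (frac r).2; first exact: denom_ratioP.
exists (frac r).1 => //; unlock tofrac.
(* The product is computed on representing ratios, where equality is cross-multiplication in [D]. *)
rewrite -[RHS]FracField.pi_mul; apply/eqmodP => /=.
rewrite FracField.equivfE /FracField.mulf !numden_Ratio ?mulf_neq0 ?oner_neq0 ?denom_ratioP // ?mul1r ?mulr1.
by rewrite mulrC.
Qed.

Lemma submodule_domain : submodule (domain D).
Proof.
split; first by exists 0; rewrite ?tofrac0.
  by move=> _ _ [x _ <-] [y _ <-]; exists (x + y); rewrite ?tofracD.
by move=> d _ [x _ <-]; exists (d * x); rewrite ?tofracM.
Qed.

Lemma submodule_generated s : submodule (generated s).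
Proof.
split.
- exists (fun=> 0); rewrite big1 // => i _; by rewrite tofrac0 mul0r.
- move=> _ _ [c ->] [c' ->]; exists (fun i => c i + c' i).
  by rewrite -big_split; apply: eq_bigr => i _; rewrite tofracD mulrDl.
- move=> d _ [c ->]; exists (fun i => d * c i).
  by rewrite mulr_sumr; apply: eq_bigr => i _; rewrite tofracM mulrA.
Qed.

Lemma submodule_sum E n (f : 'I_n -> K) :
  submodule E -> (forall i, E (f i)) -> E (\sum_(i < n) f i).
Proof. by case=> E0 ED _ Ef; apply: (big_ind E). Qed.

Lemma mem_generated s x : x \in s -> generated s x.
Proof.
move=> xs; have xs' := xs; rewrite -index_mem in xs'.
exists (fun i => if i == Ordinal xs' then 1 else 0).
rewrite (bigD1 (Ordinal xs')) //= eqxx tofrac1 mul1r nth_index //.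
by rewrite big1 ?addr0 // => i /negPf ->; rewrite tofrac0 mul0r.
Qed.

Lemma generated_sub E s :
  submodule E -> (forall x, x \in s -> E x) -> generated s `<=` E.
Proof.
move=> sE sub _ [c ->]; apply: submodule_sum => // i.
by case: sE => _ _; apply; apply: sub; rewrite mem_nth.
Qed.

Lemma generated_pair a b x : generated [:: a; b] x ->
  exists d e : D, x = d%:F * a + e%:F * b.
Proof. by case=> c ->; rewrite big_ord_recl big_ord1 /=; eexists _, _. Qed.

Lemma nonzero_fg_generated s x :
  x \in s -> x != 0 -> nonzero_fg_submodule (generated s).
Proof.
move=> xs x0; split; last by exists s.
by split; [exact: submodule_generated|exists x => //; exact: mem_generated].
Qed.

Lemma submodule_scale x E : submodule E -> submodule (scale x E).
Proof.
case=> E0 ED EZ; split; first by exists 0; rewrite ?mulr0.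
  by move=> _ _ [y Ey <-] [z Ez <-]; exists (y + z); rewrite ?mulrDr //; apply: ED.
by move=> d _ [y Ey <-]; exists (d%:F * y); [apply: EZ|ring].
Qed.

Lemma nonzero_submodule_scale x E : x != 0 ->
  nonzero_submodule E -> nonzero_submodule (scale x E).
Proof.
move=> x0 [sE [y Ey y0]]; split; first exact: submodule_scale.
by exists (x * y); [exists y|rewrite mulf_neq0].
Qed.

Lemma scale_generated x s : scale x (generated s) = generated [seq x * y | y <- s].
Proof.
rewrite eqEsubset; split; last first.
  apply: generated_sub; first exact/submodule_scale/submodule_generated.
  by move=> _ /mapP[y ys ->]; exists y => //; exact: mem_generated.
move=> _ [y sy <-].
suff: generated s `<=` [set z | generated [seq x * y | y <- s] (x * z)] by exact.
apply: generated_sub => [|z zs]; last exact/mem_generated/map_f.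
have [G0 GD GZ] := submodule_generated [seq x * y | y <- s].
split; rewrite /= ?mulr0 //.
  by move=> u v /= ? ?; rewrite mulrDr; apply: GD.
by move=> d u /= ?; rewrite mulrCA; apply: GZ.
Qed.

Lemma nonzero_fg_scale x E : x != 0 ->
  nonzero_fg_submodule E -> nonzero_fg_submodule (scale x E).
Proof.
move=> x0 [nE [s Es]]; split; first exact: nonzero_submodule_scale.
by exists [seq x * y | y <- s]; rewrite Es scale_generated.
Qed.

(** Concatenating generators gives the join; this makes the union that defines [finite_type]
    directed. *)
Lemma nonzero_fg_join E F G : submodule E ->
  nonzero_fg_submodule F -> nonzero_fg_submodule G -> F `<=` E -> G `<=` E ->
  exists H, [/\ nonzero_fg_submodule H, H `<=` E, F `<=` H & G `<=` H].
Proof.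
move=> sE [[sF [x Fx x0]] [s Fs]] [[sG _] [t Gt]] FE GE.
have FH : F `<=` generated (s ++ t).
  rewrite Fs; apply: generated_sub => [|y ys]; first exact: submodule_generated.
  by apply: mem_generated; rewrite mem_cat ys.
exists (generated (s ++ t)); split=> //.
- split; last by exists (s ++ t).
  by split; [exact: submodule_generated|exists x => //; exact: FH].
- apply: generated_sub => // y; rewrite mem_cat => /orP[ys|yt].
    by apply: FE; rewrite Fs; exact: mem_generated.
  by apply: GE; rewrite Gt; exact: mem_generated.
rewrite Gt; apply: generated_sub => [|y ys]; first exact: submodule_generated.
by apply: mem_generated; rewrite mem_cat ys orbT.
Qed.

Lemma submodule_preimage x E : submodule E -> submodule [set y | E (y * x)].
Proof.
case=> E0 ED EZ; split=> [|y z Ey Ez|d y Ey] /=; first by rewrite mul0r.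
  by rewrite mulrDl; apply: ED.
by rewrite -mulrA; apply: EZ.
Qed.

Lemma submodule_setI E F : submodule E -> submodule F -> submodule (E `&` F).
Proof.
case=> E0 ED EZ [F0 FD FZ]; split=> //.
  by move=> x y [? ?] [? ?]; split; [apply: ED|apply: FD].
by move=> d x [? ?]; split; [apply: EZ|apply: FZ].
Qed.

Lemma mul_submoduleM E F x y : E x -> F y -> mul_submodule E F (x * y).
Proof.
by move=> Ex Fy; exists 1, (fun=> x), (fun=> y); split=> //; rewrite big_ord1.
Qed.

Lemma submodule_mul E F : submodule E -> submodule (mul_submodule E F).
Proof.
case=> E0 ED EZ; split.
- by exists 0, (fun=> 0), (fun=> 0); split=> [[]|[]|] //; rewrite big_ord0.
- move=> _ _ [n [e [f [Ee Ff ->]]]] [m [e' [f' [Ee' Ff' ->]]]].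
  exists (n + m)%N, (fun i => match fintype.split i with inl j => e j | inr j => e' j end),
    (fun i => match fintype.split i with inl j => f j | inr j => f' j end).
  split=> [i|i|]; [by case: fintype.split|by case: fintype.split|].
  rewrite big_split_ord /=; congr (_ + _); apply: eq_bigr => i _.
    by rewrite (unsplitK (inl i)).
  by rewrite (unsplitK (inr i)).
- move=> d _ [n [e [f [Ee Ff ->]]]]; exists n, (fun i => d%:F * e i), f.
  split=> // [i|]; first exact: EZ.
  by rewrite mulr_sumr; apply: eq_bigr => i _; rewrite mulrA.
Qed.

Lemma mul_submodule_sub E F G : submodule G ->
  (forall x y, E x -> F y -> G (x * y)) -> mul_submodule E F `<=` G.
Proof.
by move=> sG EFG _ [n [e [f [Ee Ff ->]]]]; apply: submodule_sum => // i; exact: EFG.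
Qed.

Lemma inverse_mul I x z : I x -> inverse I z -> domain D (z * x).
Proof. by move=> Ix; apply; exists x. Qed.

Lemma nonzero_ideal_mul_inverse I :
  nonzero_ideal I -> nonzero_ideal (mul_submodule I (inverse I)).
Proof.
case=> [[sI [x Ix x0]] ID]; split.
  split; first exact: submodule_mul.
  (* As [I] lies in [D], [1] belongs to [inverse I], so the product contains [I]. *)
  exists (x * 1); last by rewrite mulr1.
  by apply: mul_submoduleM => // _ [y Iy <-]; rewrite mul1r; apply: ID.
apply: mul_submodule_sub; first exact: submodule_domain.
by move=> y z Iy Iz; rewrite mulrC; apply: inverse_mul Iz.
Qed.

End Submodules.

(** * Quasi-[star_f]-maximal ideals, their localizations and [tilde] *)

Section Quasi_maximal.
Variables (D : idomainType) (star : semistar D).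
Local Notation K := {fraction D}.
Local Notation ft := (finite_type star).
Local Notation M := (quasi_maximal ft).
Implicit Types (E F I J Q : set K) (x y : K).

Lemma sub_finite_type E : nonzero_submodule E -> E `<=` ft E.
Proof.
move=> [sE [e Ee e0]] x Ex.
(* The generator [e] keeps the submodule nonzero when [x = 0]. *)
have nF : nonzero_fg_submodule (generated [:: x; e]).
  by apply: (@nonzero_fg_generated _ _ e); rewrite ?inE ?eqxx ?orbT.
exists (generated [:: x; e]).
  split=> //; apply: generated_sub => // y.
  by rewrite !inE => /orP[]/eqP->.
by apply: star_ext; [case: nF|apply: mem_generated; rewrite inE eqxx].
Qed.

Lemma finite_type_mono E F : E `<=` F -> ft E `<=` ft F.
Proof. by move=> EF x [G [nG GE] Gx]; exists G => //; split=> // y /GE/EF. Qed.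

Lemma finite_type_directed E (s : seq K) : nonzero_submodule E ->
  (forall x, x \in s -> ft E x) ->
  exists F, [/\ nonzero_fg_submodule F, F `<=` E & forall x, x \in s -> star F x].
Proof.
move=> nE; have [sE [e Ee e0]] := nE; elim: s => [_|y s IH ys].
  exists (generated [:: e]); split=> //.
    by apply: (@nonzero_fg_generated _ _ e); rewrite ?inE.
  by apply: generated_sub => // x; rewrite inE => /eqP->.
have [x xs|F [nF FE sF]] := IH; first by apply: ys; rewrite inE xs orbT.
have [G [nG GE] Gy] := ys y (mem_head _ _).
have [H [nH HE FH GH]] := nonzero_fg_join sE nF nG FE GE.
exists H; split=> // x; rewrite inE => /orP[/eqP->|xs].
  by apply: star_mono Gy => //; [case: nG|case: nH].
by apply: star_mono (sF x xs) => //; [case: nF|case: nH].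
Qed.

(** This carries the idempotence of [star_f]: the finitely many generators of [F] lie in one
    [star G], so [star F] lies in [star (star G) = star G]. *)
Lemma star_sub_finite_type E F : nonzero_submodule E ->
  nonzero_fg_submodule F -> F `<=` ft E -> star F `<=` ft E.
Proof.
move=> nE [nF [s Fs]] FE x Fx.
have [y ys|G [nG GE sG]] := @finite_type_directed E s nE.
  by apply: FE; rewrite Fs; exact: mem_generated.
have nsG : nonzero_submodule (star G) by apply: star_submodule; case: nG.
exists G => //; rewrite -star_idem; last by case: nG.
apply: star_mono Fx => //; rewrite Fs; apply: generated_sub => //.
by case: nsG.
Qed.

Lemma nonzero_submodule_finite_type E :
  nonzero_submodule E -> nonzero_submodule (ft E).
Proof.
move=> nE; have [sE [e Ee e0]] := nE; split; last first.
  by exists e => //; exact: sub_finite_type.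
split; first by apply: sub_finite_type => //; case: sE.
  move=> x y Ex Ey.
  have [z|F [nF FE sF]] := @finite_type_directed E [:: x; y] nE.
    by rewrite !inE => /orP[]/eqP->.
  have [[_ FD _] _] : nonzero_submodule (star F).
    by apply: star_submodule; case: nF.
  by exists F => //; apply: FD; apply: sF; rewrite !inE eqxx ?orbT.
move=> d x [F [nF FE] Fx]; exists F => //.
have [[_ _ FZ] _] : nonzero_submodule (star F).
  by apply: star_submodule; case: nF.
exact: FZ.
Qed.

Lemma domain_sub_submodule E : submodule E -> E 1 -> domain D `<=` E.
Proof. by case=> _ _ EZ E1 _ [d _ <-]; rewrite -[_%:F]mulr1; apply: EZ. Qed.

Lemma sub_quasi_closure I : nonzero_ideal I -> I `<=` ft I `&` domain D.
Proof. by case=> nI ID x Ix; split; [exact: sub_finite_type|exact: ID]. Qed.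

Lemma quasi_ideal_closure I :
  nonzero_ideal I -> quasi_ideal ft (ft I `&` domain D).
Proof.
move=> nI; have [nsI ID] := nI; have [sI [e Ie e0]] := nsI.
have nC : nonzero_ideal (ft I `&` domain D).
  split; last by move=> x [].
  split; last by exists e => //; apply: sub_quasi_closure.
  apply: submodule_setI; last exact: submodule_domain.
  by case: (nonzero_submodule_finite_type nsI).
split=> //; rewrite eqEsubset; split; first exact: sub_quasi_closure.
move=> x [[F [nF FI] Fx] Dx]; split=> //.
by apply: star_sub_finite_type Fx => // y /FI[].
Qed.

Lemma quasi_maximal_ideal Q : M Q -> nonzero_ideal Q.
Proof. by case=> [[]]. Qed.

Lemma quasi_maximal_closed Q x : M Q -> domain D x -> ft Q x -> Q x.
Proof. by case=> [[_ QE] _ _] Dx Qx; rewrite QE. Qed.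

Lemma quasi_maximal_not1 Q : M Q -> ~ Q 1.
Proof.
move=> [[[[sQ _] QD] _] QnD _] Q1; apply: QnD; rewrite eqEsubset; split=> //.
exact: domain_sub_submodule.
Qed.

Lemma domain1 : domain D 1. Proof. by exists 1; rewrite ?tofrac1. Qed.

(** Zorn's lemma applies because [star_f] has finite type: if [1] were in the closure of the union
    of a chain, finitely many generators would be responsible, and they already lie in one member of
    the chain. *)
Lemma exists_quasi_maximal J : nonzero_ideal J -> ~ ft J 1 ->
  exists2 Q, M Q & J `<=` Q.
Proof.
move=> nJ J1.
pose good Q := [/\ nonzero_ideal Q, J `<=` Q & ~ ft Q 1].
pose P Q := Q = set0 \/ good Q.
have [j Jj j0] : exists2 j, J j & j != 0 by case: nJ => -[].
have [F FP totF|Q [PQ maxQ]] := @Zorn_bigcup _ P.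
  have [[X0 FX0 gX0]|none] := pselect (exists2 X, F X & good X); last first.
    left; rewrite -subset0 => x [X FX Xx].
    have [X0|gX] := FP X FX; first by rewrite X0 in Xx.
    by apply: none; exists X.
  have goodP X x : F X -> X x -> good X.
    by move=> FX Xx; have [X0'|//] := FP X FX; rewrite X0' in Xx.
  have comp X Y x y : F X -> F Y -> X x -> Y y ->
      exists Z, [/\ F Z, good Z, Z x & Z y].
    move=> FX FY Xx Yy; have [XY|YX] := totF X Y FX FY.
      by exists Y; split=> //; [exact: goodP Yy|exact: XY].
    by exists X; split=> //; [exact: goodP Xx|exact: YX].
  right; have [nX0 JX0 X01] := gX0; split.
  - split; last by move=> x [X FX Xx]; have [[_ XD] _ _] := goodP X x FX Xx; exact: XD.
    split; last by exists j => //; exists X0 => //; exact: JX0.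
    split; first by exists X0 => //; case: nX0 => -[[]].
      move=> x y [X FX Xx] [Y FY Yy].
      have [Z [FZ [[[[_ ZD _] _] _] _ _] Zx Zy]] := comp X Y x y FX FY Xx Yy.
      by exists Z => //; apply: ZD.
    move=> d x [X FX Xx]; exists X => //.
    by have [[[[_ _ XZ] _] _] _ _] := goodP X x FX Xx; apply: XZ.
  - by move=> x Jx; exists X0 => //; exact: JX0.
  - move=> [G [nG GU] G1]; have [_ [s Gs]] := nG.
    suff [Z [FZ gZ sZ]] : exists Z, [/\ F Z, good Z & forall x, x \in s -> Z x].
      have [[[sZ' _] _] _ Z1] := gZ; apply: Z1; exists G => //; split=> //.
      by rewrite Gs; exact: generated_sub.
    have : forall x, x \in s -> (\bigcup_(X in F) X) x.
      by move=> x xs; apply: GU; rewrite Gs; exact: mem_generated.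
    elim: (s) => [_|y t IH ts]; first by exists X0; split.
    have [x xt|Z [FZ gZ tZ]] := IH; first by apply: ts; rewrite inE xt orbT.
    have [Y FY Yy] := ts y (mem_head _ _).
    have gY := goodP Y y FY Yy.
    have [ZY|YZ] := totF Z Y FZ FY.
      exists Y; split=> // x; rewrite inE => /orP[/eqP->//|/tZ]; exact: ZY.
    exists Z; split=> // x; rewrite inE => /orP[/eqP->|/tZ//]; exact: YZ.
have gQ : good Q.
  case: PQ => // Q0; exfalso; apply: (maxQ J); last by right; split.
  by rewrite Q0; split=> // /(_ j Jj).
have maxE I : good I -> Q `<=` I -> I = Q.
  move=> gI QI; rewrite eqEsubset; split=> //; apply: contrapT => IQ.
  by apply: (maxQ I); [split|right].
have [nQ JQ Q1] := gQ.
exists Q => //; split.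
(* The closure of [Q] in [D] is again good, so maximality forces it to be [Q]. *)
- have CE : ft Q `&` domain D = Q.
    apply: maxE; last exact: sub_quasi_closure.
    have [nC CE] := quasi_ideal_closure nQ; split=> //.
      by move=> x /JQ; exact: sub_quasi_closure.
    move=> C1; have : (ft Q `&` domain D) 1.
      by rewrite CE; split=> //; exact: domain1.
    by case.
  by rewrite -CE; exact: quasi_ideal_closure.
- by move=> QD; apply: Q1; apply: sub_finite_type; [case: nQ|rewrite QD; exact: domain1].
move=> I [nI IE] InD QI; apply: maxE => //; split=> //.
  by move=> x /JQ/QI.
move=> I1; apply: InD; rewrite eqEsubset; split; first by case: nI.
apply: domain_sub_submodule; first by case: nI => -[].
by rewrite IE; split=> //; exact: domain1.
Qed.

Lemma quasi_maximal_not_finite_type1 Q : M Q -> ~ ft Q 1.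
Proof.
move=> MQ Q1; apply: (quasi_maximal_not1 MQ).
by apply: quasi_maximal_closed => //; exact: domain1.
Qed.

(** If [J] were inside [Q], its closure would be inside that of [Q], which misses [1]. With
    [exists_quasi_maximal], [ft J 1] thus amounts to [J] lying in no quasi-maximal ideal. *)
Lemma finite_type1_not_sub J Q : nonzero_ideal J -> M Q -> ft J 1 ->
  exists2 s : D, ~ Q s%:F & J s%:F.
Proof.
move=> [_ JD] MQ J1; apply: contrapT => none.
apply: (quasi_maximal_not_finite_type1 MQ); apply: finite_type_mono J1 => x Jx.
have [d _ dx] := JD x Jx; rewrite -dx; apply: contrapT => Qd.
by apply: none; exists d => //; rewrite dx.
Qed.

(** If [s] is outside [Q], maximality puts [1] in the closure of [J = Q + sD], hence in [star F] for
    a finitely generated [F] inside [J]. If moreover [st] is in [Q], then [tF] lies in [Q], so [t],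
    being in [star (tF)], is in the closure of [Q] and thus in [Q]. *)
Lemma quasi_maximal_prime Q (s t : D) : M Q ->
  ~ Q s%:F -> ~ Q t%:F -> ~ Q (s * t)%:F.
Proof.
move=> MQ Qs Qt Qst.
have [nsQ QD] := quasi_maximal_ideal MQ; have [[Q0 QA QZ] [q Qq q0]] := nsQ.
have t0 : t%:F != 0 by apply/eqP => t0; apply: Qt; rewrite t0.
pose J := [set x | exists y (d : D), Q y /\ x = y + d%:F * s%:F].
have QJ : Q `<=` J by move=> y Qy; exists y, 0; rewrite tofrac0 mul0r addr0.
have nJ : nonzero_ideal J.
  split; last first.
    move=> _ [y [d [Qy ->]]]; have [_ DD DZ] := submodule_domain D.
    by apply: DD; [exact: QD|apply: DZ; exists s].
  split; last by exists q => //; exact: QJ.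
  split; first exact: QJ.
    move=> _ _ [y [d [Qy ->]]] [y' [d' [Qy' ->]]].
    by exists (y + y'), (d + d'); split; [exact: QA|rewrite tofracD; ring].
  move=> c _ [y [d [Qy ->]]]; exists (c%:F * y), (c * d).
  by split; [exact: QZ|rewrite tofracM; ring].
have [[F [nF FJ] F1]|] := pselect (ft J 1); last first.
  move=> J1; have [Q' MQ' JQ'] := exists_quasi_maximal nJ J1.
  have QQ' : Q' = Q.
    case: MQ => _ _; apply; [by case: MQ'|by case: MQ'|by move=> x /QJ/JQ'].
  apply: Qs; rewrite -QQ'; apply: JQ'; exists 0, 1; split=> //.
  by rewrite tofrac1; ring.
apply: Qt; apply: quasi_maximal_closed => //; first by exists t.
exists (scale t%:F F).
  split; first exact: nonzero_fg_scale.
  move=> _ [x Fx <-]; have [y [d [Qy ->]]] := FJ x Fx.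
  have -> : t%:F * (y + d%:F * s%:F) = t%:F * y + d%:F * (s * t)%:F.
    by rewrite tofracM; ring.
  by apply: QA; apply: QZ.
by rewrite star_scale //; [exists 1; rewrite ?mulr1|case: nF].
Qed.

(** For a submodule [E] and a quasi-maximal [Q] this is [E D_Q], see [mul_localization]; a single
    denominator replaces finite sums of products. *)
Definition at_loc Q E : set K := [set x | exists2 s : D, ~ Q s%:F & E (s%:F * x)].

Lemma at_loc_sub Q E : M Q -> E `<=` at_loc Q E.
Proof.
by move=> MQ x Ex; exists 1; rewrite tofrac1 ?mul1r //; exact: quasi_maximal_not1.
Qed.

Lemma at_loc_mono Q E F : E `<=` F -> at_loc Q E `<=` at_loc Q F.
Proof. by move=> EF x [s Qs Es]; exists s => //; exact: EF. Qed.

Lemma at_loc_idem Q E : M Q -> at_loc Q (at_loc Q E) `<=` at_loc Q E.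
Proof.
move=> MQ x [s Qs [t Qt Ex]]; exists (t * s); first exact: quasi_maximal_prime.
by rewrite tofracM -mulrA.
Qed.

Lemma submodule_at_loc Q E : M Q -> submodule E -> submodule (at_loc Q E).
Proof.
move=> MQ [E0 ED EZ]; split; first exact: at_loc_sub.
  move=> x y [s Qs Ex] [t Qt Ey]; exists (s * t); first exact: quasi_maximal_prime.
  have -> : (s * t)%:F * (x + y) = t%:F * (s%:F * x) + s%:F * (t%:F * y).
    by rewrite tofracM; ring.
  by apply: ED; apply: EZ.
move=> d x [s Qs Ex]; exists s => //.
by rewrite mulrCA; apply: EZ.
Qed.

Lemma mul_localization Q E : M Q -> submodule E ->
  mul_submodule E (localization Q) = at_loc Q E.
Proof.
move=> MQ sE; rewrite eqEsubset; split.
  apply: mul_submodule_sub; first exact: submodule_at_loc.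
  move=> x _ Ex [d [s [Qs ->]]]; exists s => //.
  have s0 : s%:F != 0.
    by apply/eqP => s0; apply: Qs; rewrite s0; case: (quasi_maximal_ideal MQ) => -[[]].
  have -> : s%:F * (x * (d%:F / s%:F)) = d%:F * x.
    by rewrite mulrCA [s%:F * _]mulrC divfK // mulrC.
  by case: sE => _ _; apply.
move=> x [s Qs Ex].
have s0 : s%:F != 0.
  by apply/eqP => s0; apply: Qs; rewrite s0; case: (quasi_maximal_ideal MQ) => -[[]].
rewrite (_ : x = (s%:F * x) * (1%:F / s%:F)); last by rewrite tofrac1 div1r mulrC mulKf.
by apply: mul_submoduleM => //; exists 1, s.
Qed.

Lemma tildeP E x : submodule E ->
  tilde star E x <-> forall Q, M Q -> at_loc Q E x.
Proof.
by move=> sE; split=> Ex Q MQ; have := Ex Q MQ; rewrite mul_localization.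
Qed.

Lemma sub_tilde E : submodule E -> E `<=` tilde star E.
Proof. by move=> sE x Ex; apply/tildeP => // Q MQ; exact: at_loc_sub. Qed.

(** That [x] is in [E D_Q] says that the ideal [(E : x)] of [D] is not inside [Q]. When this holds
    for every [Q], the [star_f]-closure of that ideal contains [1], witnessed by a finitely
    generated [F]: this is how [tilde] is of finite type. *)
Lemma tilde_colon E x : nonzero_submodule E -> x != 0 -> tilde star E x ->
  exists F, [/\ nonzero_fg_submodule F, F `<=` domain D,
    F `<=` [set y | E (y * x)] & star F 1].
Proof.
move=> [sE [e Ee e0]] x0 /(tildeP _ sE) Ex.
pose J := [set y | E (y * x)] `&` domain D.
have nJ : nonzero_ideal J.
  split; last by move=> y [].
  split; first by apply: submodule_setI; [exact: submodule_preimage|exact: submodule_domain].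
  (* Clearing the denominator of [e / x] gives a nonzero element of [J]. *)
  have [d d0 [n _ nE]] := fraction_numden (e / x).
  exists (d%:F * (e / x)); last first.
    by apply: mulf_neq0; [rewrite tofrac_eq0|apply: mulf_neq0 => //; rewrite invr_eq0].
  split; last by exists n.
  have dxE : d%:F * (e / x) * x = d%:F * e by rewrite -mulrA divfK.
  by change (E (d%:F * (e / x) * x)); rewrite dxE; case: sE => _ _; apply.
have [[F [nF FJ] F1]|J1] := pselect (ft J 1).
  by exists F; split=> // y /FJ[].
have [Q MQ JQ] := exists_quasi_maximal nJ J1.
have [s Qs Es] := Ex Q MQ.
by exfalso; apply: Qs; apply: JQ; split=> //; exists s.
Qed.

End Quasi_maximal.
Arguments tildeP {D star E x}.

(** * (2) implies (1): local principality, invertibility, chain condition *)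

Section Two_generators_imply_dedekind.
Variables (D : idomainType) (star : semistar D).
Local Notation K := {fraction D}.
Local Notation ft := (finite_type star).
Local Notation M := (quasi_maximal ft).
Implicit Types (E F I J Q : set K) (x y : K).

Definition two_generated := forall I, nonzero_ideal I ->
  forall a, I a -> a != 0 ->
  exists b, tilde star I b /\ tilde star I = tilde star (generated [:: a; b]).

(* Taking the first generator in [Q * I] makes it superfluous at [Q], as in
   Nakayama's lemma. *)
Lemma two_generated_local_principal I Q : two_generated -> nonzero_ideal I -> M Q ->
  exists2 c, at_loc Q I c &
    forall x, I x -> exists s d : D, ~ Q s%:F /\ s%:F * x = d%:F * c.
Proof.
move=> gen2 nI MQ; have [[sI [a Ia a0]] _] := nI.
have [[_ [q Qq q0]] QD] := quasi_maximal_ideal MQ.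
have [q' _ q'E] := QD q Qq; rewrite -q'E in Qq q0.
have Iqa : I (q'%:F * a) by case: sI => _ _; apply.
have [b [Ib IE]] := gen2 I nI _ Iqa (mulf_neq0 q0 a0).
have loc x : I x -> exists s d e : D,
    ~ Q s%:F /\ s%:F * x = d%:F * (q'%:F * a) + e%:F * b.
  move=> Ix; have : tilde star I x by exact: sub_tilde.
  rewrite IE => /tildeP /(_ Q MQ)[]; first exact: submodule_generated.
  by move=> s Qs /generated_pair[d [e sx]]; exists s, d, e.
have [s [d [e [Qs sa]]]] := loc a Ia.
(* The relation for [a] reads [(s - d q') a = e b], so once [s - d q'] is known to be outside [Q],
   [b] alone generates at [Q]. *)
have Qt : ~ Q (s - d * q')%:F.
  move=> Qt; apply: Qs; rewrite -[s](subrK (d * q')) tofracD.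
  case: (quasi_maximal_ideal MQ) => -[[_ QA QZ] _] _.
  by apply: QA => //; rewrite tofracM; apply: QZ.
exists b; first exact: (proj1 (tildeP sI) Ib Q MQ).
move=> x /loc[s' [d' [e' [Qs' s'x]]]].
exists ((s - d * q') * s'), (d' * q' * e + (s - d * q') * e').
split; first exact: (quasi_maximal_prime MQ Qt Qs').
have tb : (s%:F - d%:F * q'%:F) * a = e%:F * b by rewrite mulrBl sa; ring.
rewrite !(tofracM, tofracB, tofracD) -mulrA s'x mulrDr.
transitivity (d'%:F * q'%:F * ((s%:F - d%:F * q'%:F) * a)
  + (s%:F - d%:F * q'%:F) * e'%:F * b); first ring.
by rewrite tb; ring.
Qed.

Lemma common_denominator Q c (s : seq K) : M Q ->
  (forall x, x \in s -> exists t d : D, ~ Q t%:F /\ t%:F * x = d%:F * c) ->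
  exists2 t : D, ~ Q t%:F &
    forall x, x \in s -> exists d : D, t%:F * x = d%:F * c.
Proof.
move=> MQ; elim: s => [_|y s IH sP].
  by exists 1 => //; rewrite tofrac1; exact: (quasi_maximal_not1 MQ).
have [x xs|t Qt tP] := IH; first by apply: sP; rewrite inE xs orbT.
have [t' [d' [Qt' ty]]] := sP y (mem_head _ _).
exists (t * t'); first exact: (quasi_maximal_prime MQ Qt Qt').
move=> x; rewrite inE => /orP[/eqP->|/tP[d tx]].
  by exists (t * d'); rewrite !tofracM -!mulrA ty.
by exists (t' * d); rewrite !tofracM mulrAC tx mulrC mulrA.
Qed.

(** Suppose [I I^-1] lies in [Q]. With [c] a generator of [I] at [Q], finite generation gives one
    [t] outside [Q] with [tI] inside [cD], so [t / c] is in [I^-1]; some [sc] with [s] outside [Q]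
    is in [I]. Then [st = (sc)(t / c)] is in [Q], against primeness. *)
Lemma two_generated_prufer : two_generated -> star_prufer star.
Proof.
move=> gen2 I nI [nsI [l Il]]; set J := mul_submodule I (inverse I).
have nJ : nonzero_ideal J by exact: nonzero_ideal_mul_inverse.
have J1 : ft J 1.
  apply: contrapT => J1; have [Q MQ JQ] := exists_quasi_maximal nJ J1.
  have [c [s Qs Ic] cP] := two_generated_local_principal gen2 nI MQ.
  have [x xl|t Qt tP] := @common_denominator Q c l MQ.
    by apply: cP; rewrite Il; exact: mem_generated.
  have tI : I `<=` [set x | scale c (domain D) (t%:F * x)].
    rewrite [I in I `<=` _]Il; apply: generated_sub.
      have [P0 PD PZ] := submodule_scale c (submodule_domain D).
      split=> [|x y ? ?|d x ?] /=; first by rewrite mulr0.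
        by rewrite mulrDr; apply: PD.
      by rewrite mulrCA; apply: PZ.
    move=> x /tP[d tx]; exists d%:F; first by exists d.
    by rewrite tx mulrC.
  have c0 : c != 0.
    have [_ [x Ix x0]] := nsI; apply/eqP => c0.
    have [y _] := tI x Ix; rewrite c0 mul0r => /esym/eqP.
    rewrite mulf_eq0 (negPf x0) orbF => /eqP t0; apply: Qt; rewrite t0.
    by case: (quasi_maximal_ideal MQ) => -[[]].
  apply: (quasi_maximal_prime MQ Qs Qt); apply: JQ.
  have -> : (s * t)%:F = (s%:F * c) * (t%:F / c).
    by rewrite tofracM -mulrA [c * _]mulrC divfK.
  apply: mul_submoduleM => // _ [x /tI[e De ex] <-].
  by rewrite mulrAC -ex mulrAC divff // mul1r.
have nfJ : nonzero_submodule (ft J).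
  by apply: nonzero_submodule_finite_type; case: nJ.
rewrite /star_invertible eqEsubset; split.
  by apply: finite_type_mono; case: nJ.
move=> x [F [nF FD] Fx]; apply: star_sub_finite_type Fx => //; first by case: nJ.
by move=> y /FD; apply: domain_sub_submodule => //; case: nfJ.
Qed.

(** With [F] from [tilde_colon], [xF] lies in [E] and [1] in [star F], so [x] lies in
    [x (star F) = star (xF)]. *)
Lemma tilde_sub_star E : nonzero_submodule E -> tilde star E `<=` star E.
Proof.
move=> nE x Ex; have [-> |/eqP x0] := pselect (x = 0).
  by case: (star_submodule star nE) => -[].
have [F [nF FD FE F1]] := tilde_colon nE x0 Ex.
have nsF : nonzero_submodule F by case: nF.
apply: (@star_mono _ star (scale x F)) => //.
- exact: nonzero_submodule_scale.
- by move=> _ [y /FE Ey <-]; rewrite mulrC.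
by rewrite star_scale //; exists 1; rewrite ?mulr1.
Qed.

Lemma two_generated_noetherian : two_generated -> star_noetherian star.
Proof.
move=> gen2 I qI Imono.
have mono m n : (m <= n)%N -> I m `<=` I n.
  move=> /subnK <-; elim: (n - m)%N => [|k IH] x //.
  by move=> /IH; rewrite addSn; exact: Imono.
pose U := \bigcup_n I n.
have [[[I0 [a Ia a0]] _] _] := qI 0%N.
have nU : nonzero_ideal U.
  split; last by move=> x [n _ Ix]; have [[_ ID] _] := qI n; exact: ID.
  split; last by exists a => //; exists 0%N.
  split; first by exists 0%N => //; case: I0.
    move=> x y [n _ Ix] [m _ Iy]; exists (maxn n m) => //.
    have [[[[_ ID _] _] _] _] := qI (maxn n m).
    by apply: ID; [apply: mono Ix; exact: leq_maxl|apply: mono Iy; exact: leq_maxr].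
  move=> d x [n _ Ix]; exists n => //.
  by have [[[[_ _ IZ] _] _] _] := qI n; apply: IZ.
have Ua : U a by exists 0%N.
have [b [Ub UE]] := gen2 U nU a Ua a0.
have sU : submodule U by case: nU => -[].
(* Then each [I n] lies in [tilde U], hence in [tilde (I N)] and in [star (I N)], whose trace on [D]
   is [I N]. *)
suff [N NP] : exists N, tilde star (generated [:: a; b]) `<=` tilde star (I N).
  exists N => n Nn; rewrite eqEsubset; split; last exact: mono.
  move=> x Ix; have [nIN ->] := qI N; split.
    apply: tilde_sub_star; first by case: nIN.
    by apply: NP; rewrite -UE; apply: sub_tilde => //; exists n.
  by have [[_ ID] _] := qI n; exact: ID.
have sG := @submodule_generated D [:: a; b].
have sI n : submodule (I n) by case: (qI n) => -[[]].
have [b0|/eqP b0] := pselect (b = 0).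
  exists 0%N => x /(tildeP sG) Gx; apply/tildeP => // Q MQ.
  apply: at_loc_mono (Gx Q MQ); apply: generated_sub => // y.
  by rewrite !inE => /orP[]/eqP-> //; rewrite b0; case: (sI 0%N).
(* [F] multiplies [b] into [U]; being finitely generated, it already multiplies [b] into some
   [I N]. *)
have [F [nF FD FU F1]] := tilde_colon (proj1 nU) b0 Ub.
have [nsF [l Fl]] := nF.
have [N NP] : exists N, forall y, y \in l -> I N (y * b).
  have : forall y, y \in l -> U (y * b).
    by move=> y yl; apply: FU; rewrite Fl; exact: mem_generated.
  elim: (l) => [|y t IH ts]; first by exists 0%N.
  have [x xt|N NP] := IH; first by apply: ts; rewrite inE xt orbT.
  have [m _ Im] := ts y (mem_head _ _).
  exists (maxn N m) => x; rewrite inE => /orP[/eqP->|/NP].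
    by apply: mono Im; exact: leq_maxr.
  by apply: mono; exact: leq_maxl.
have FN : F `<=` [set y | I N (y * b)].
  by rewrite Fl; apply: generated_sub => //; exact: submodule_preimage.
exists N => x /(tildeP sG) Gx; apply/tildeP => // Q MQ.
apply: (at_loc_idem MQ); apply: at_loc_mono (Gx Q MQ).
apply: generated_sub; first exact: (submodule_at_loc MQ).
move=> y; rewrite !inE => /orP[]/eqP->.
  by apply: (at_loc_sub MQ); apply: mono Ia.
have nFi : nonzero_ideal F by split.
have ftF : ft F 1 by exists F => //; split.
have [s Qs Fs] := finite_type1_not_sub nFi MQ ftF.
by exists s => //; exact: (FN _ Fs).
Qed.

End Two_generators_imply_dedekind.

(** * (1) implies (2): local principality, separation, choice of [b] *)

Section Dedekind_implies_two_generators.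
Variables (D : idomainType) (star : semistar D).
Hypotheses (noeth : star_noetherian star) (prufer : star_prufer star).
Local Notation K := {fraction D}.
Local Notation ft := (finite_type star).
Local Notation M := (quasi_maximal ft).
Implicit Types (E F I J Q : set K) (x y : K).

Lemma star_noetherian_maximal (P : set (set K)) : P !=set0 ->
  (forall A, P A -> quasi_ideal star A) ->
  exists2 A, P A & forall B, P B -> A `<=` B -> B = A.
Proof.
move=> [A0 PA0] Pq; apply: contrapT => none.
have next (A : {A | P A}) : exists B : {A | P A},
    sval A `<=` sval B /\ sval B <> sval A.
  case: A => A PA /=; apply: contrapT => noB; apply: none; exists A => // B PB AB.
  by apply: contrapT => BA; apply: noB; exists (exist _ B PB).
have [f fP] := choice next.
pose u n := iter n f (exist _ A0 PA0).
have [N NP] := noeth (fun n => Pq _ (svalP (u n))) (fun n => proj1 (fP (u n))).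
by have [_] := fP (u N); apply; apply: (NP N.+1); exact: leqnSn.
Qed.

Lemma star_quasi_closure I : nonzero_ideal I ->
  quasi_ideal star (star I `&` domain D).
Proof.
move=> [nI ID]; have [sI [e Ie e0]] := nI; have [ssI _] := star_submodule star nI.
have nC : nonzero_submodule (star I `&` domain D).
  split; first by apply: submodule_setI => //; exact: submodule_domain.
  by exists e => //; split; [exact: star_ext|exact: ID].
split; first by split=> // x [].
rewrite eqEsubset; split=> x [Ix Dx]; split=> //; first by apply: star_ext.
rewrite -star_idem //; apply: star_mono Ix => //; first exact: star_submodule.
Qed.

(** Choose [J] with the trace of [star J] on [D] maximal: adjoining any [x] of [I] to [J] cannot
    enlarge it, so it contains [x]. *)
Lemma exists_fg_star_dense I : nonzero_ideal I ->
  exists J, [/\ nonzero_fg_submodule J, J `<=` I & I `<=` star J].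
Proof.
move=> nI; have [[sI [e Ie e0]] ID] := nI.
pose P := [set A | exists J, [/\ nonzero_fg_submodule J, J `<=` I &
  A = star J `&` domain D]].
have [||A [J [nJ JI AE]] Amax] := @star_noetherian_maximal P.
- exists (star (generated [:: e]) `&` domain D), (generated [:: e]); split=> //.
    by apply: (@nonzero_fg_generated _ _ e); rewrite ?inE.
  by apply: generated_sub => // x; rewrite inE => /eqP->.
- move=> _ [J [[nJ _] JI ->]]; apply: star_quasi_closure.
  by split=> // x /JI/ID.
exists J; split=> // x Ix.
have nxe : nonzero_fg_submodule (generated [:: x; e]).
  by apply: (@nonzero_fg_generated _ _ e); rewrite // !inE eqxx orbT.
have xeI : generated [:: x; e] `<=` I.
  by apply: generated_sub => // z; rewrite !inE => /orP[]/eqP->.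
have [H [nH HI JH xH]] := nonzero_fg_join sI nJ nxe JI xeI.
have Hx : H x by apply: xH; apply: mem_generated; rewrite inE eqxx.
have HE : star H `&` domain D = A.
  apply: Amax; first by exists H.
  rewrite AE => y [Jy Dy]; split=> //.
  by apply: star_mono Jy => //; [case: nJ|case: nH].
have : (star J `&` domain D) x.
  by rewrite -AE -HE; split; [apply: star_ext => //; case: nH|exact: ID].
by case.
Qed.

(** As [Q] is closed under sums, an element of [I I^-1] outside [Q] yields a single product outside
    [Q]. Such an [x] generates [I] at [Q], since [u y = (z y) x] for [y] in [I]. *)
Lemma prufer_local_inverse Q I : M Q -> nonzero_ideal I -> nonzero_fg_submodule I ->
  exists x z (u : D), [/\ I x, inverse I z, x * z = u%:F & ~ Q u%:F].
Proof.
move=> MQ nI fI; apply: contrapT => none.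
have nJ := nonzero_ideal_mul_inverse nI.
have [s Qs Js] : exists2 s : D, ~ Q s%:F & mul_submodule I (inverse I) s%:F.
  apply: (finite_type1_not_sub nJ MQ); rewrite (prufer nI fI).
  apply: sub_finite_type; last exact: domain1.
  split; first exact: submodule_domain.
  by exists 1; [exact: domain1|exact: oner_neq0].
apply: Qs; apply: mul_submodule_sub Js; first by case: (quasi_maximal_ideal MQ) => -[].
move=> x z Ix Iz; have [u _ uE] := inverse_mul Ix Iz.
rewrite mulrC -uE; apply: contrapT => Qu.
by apply: none; exists x, z, u; split=> //; rewrite mulrC uE.
Qed.

(** Take a local inverse [w] of a finitely generated [G] that contains [F] and [x] and lies in
    [star F]. If [wF] were inside [Q], then [u = wg], an element of [star (wF)], would be in [Q]. So
    some [e = wf] with [f] in [F] is outside [Q], and [e x = (w x) f] is in [F]. *)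
Lemma prufer_star_sub_at_loc Q F x : M Q -> nonzero_ideal F ->
  nonzero_fg_submodule F -> domain D x -> star F x -> at_loc Q F x.
Proof.
move=> MQ [nF FD] fF Dx Fx; have sF := proj1 nF.
have [F0|/eqP x0] := pselect (x = 0).
  by rewrite F0; apply: (at_loc_sub MQ); case: sF.
have fx : nonzero_fg_submodule (generated [:: x]).
  by apply: (@nonzero_fg_generated _ _ x); rewrite ?inE.
have sC : submodule (star F `&` domain D).
  by apply: submodule_setI; [case: (star_submodule star nF)|exact: submodule_domain].
have FC : F `<=` star F `&` domain D.
  by move=> y Fy; split; [exact: star_ext|exact: FD].
have xC : generated [:: x] `<=` star F `&` domain D.
  by apply: generated_sub => // y; rewrite inE => /eqP->.
have [G [fG GC FG xG]] := nonzero_fg_join sC fF fx FC xC.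
have Gx : G x by apply: xG; apply: mem_generated; rewrite inE.
have nG : nonzero_ideal G by split; [case: fG|move=> y /GC[]].
have [g [w [u [Gg Gw gw Qu]]]] := prufer_local_inverse MQ nG fG.
have [d _ dx] := inverse_mul Gx Gw.
have [[[Q0 _ QZ] _] QD] := quasi_maximal_ideal MQ.
have w0 : w != 0.
  by apply/eqP => w0; apply: Qu; rewrite -gw w0 mulr0.
have [f [e [Ff fw Qe]]] : exists f (e : D), [/\ F f, w * f = e%:F & ~ Q e%:F].
  apply: contrapT => none; apply: Qu; rewrite -gw.
  apply: (quasi_maximal_closed MQ); first by rewrite gw; exists u.
  exists (scale w F).
    split; first exact: nonzero_fg_scale.
    move=> _ [y Fy <-]; have [e _ ey] := inverse_mul (FG _ Fy) Gw.
    by rewrite -ey; apply: contrapT => Qe; apply: none; exists y, e.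
  by rewrite star_scale //; exists g; [case: (GC g Gg)|rewrite mulrC].
exists e => //; rewrite -fw mulrAC -dx.
by case: sF => _ _; apply.
Qed.

Lemma dedekind_at_loc_fg I : nonzero_ideal I ->
  exists J, [/\ nonzero_ideal J, nonzero_fg_submodule J, J `<=` I &
    forall Q, M Q -> I `<=` at_loc Q J].
Proof.
move=> nI; have [J [fJ JI IJ]] := exists_fg_star_dense nI.
have nJ : nonzero_ideal J by split; [case: fJ|move=> x /JI; case: nI => _; apply].
exists J; split=> // Q MQ x Ix; apply: (prufer_star_sub_at_loc MQ) => //; last exact: IJ.
by case: nI => _; apply.
Qed.

Lemma dedekind_local_principal I Q : nonzero_ideal I -> M Q ->
  exists2 c, I c & forall x, I x -> exists s d : D, ~ Q s%:F /\ s%:F * x = d%:F * c.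
Proof.
move=> nI MQ; have [J [nJ fJ JI IJ]] := dedekind_at_loc_fg nI.
have [c [z [u [Jc Jz cz Qu]]]] := prufer_local_inverse MQ nJ fJ.
exists c; first exact: JI.
move=> x /(IJ Q MQ)[s Qs Jx]; have [d _ dx] := inverse_mul Jx Jz.
exists (u * s), d; split; first exact: (quasi_maximal_prime MQ Qu Qs).
by rewrite dx tofracM -cz; ring.
Qed.

(** This makes the chain condition available for traces of [tilde] on [D]. With [J] finitely
    generated and dense in [B], [star B] lies in [star J], whose elements in [D] are in every
    [J D_Q]. *)
Lemma locally_closed_quasi_ideal B : nonzero_ideal B ->
  (forall x, domain D x -> (forall Q, M Q -> at_loc Q B x) -> B x) ->
  quasi_ideal star B.
Proof.
move=> nB Bloc; split=> //; have [nsB BD] := nB; rewrite eqEsubset; split=> x.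
  by move=> Bx; split; [exact: star_ext|exact: BD].
move=> [Bx Dx]; apply: Bloc => // Q MQ.
have [J [fJ JB BJ]] := exists_fg_star_dense nB; have [nsJ _] := fJ.
apply: (at_loc_mono JB); apply: (prufer_star_sub_at_loc MQ) => //.
  by split=> // y /JB/BD.
rewrite -star_idem //; apply: star_mono Bx => //; exact: star_submodule.
Qed.

Lemma quasi_maximal_incomparable Q Q' : M Q -> M Q' -> Q `<=` Q' -> Q' = Q.
Proof. by case=> _ _ maxQ [qQ' Q'D _]; exact: maxQ. Qed.

(* [t] exists because the ideal of all x lying in [a D_Q'] for every [Q' <> Q]
   is not contained in [Q]: otherwise, being locally generated at [Q] by some
   [c], it would also contain a multiple of [z * c] by an element outside [Q],
   where [z] is a local inverse of [Q] at [Q]. *)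
Lemma dedekind_separate Q a : M Q -> domain D a -> a != 0 ->
  exists2 t : D, ~ Q t%:F & forall Q', M Q' -> Q' <> Q ->
    exists s d : D, ~ Q' s%:F /\ s%:F * t%:F = d%:F * a.
Proof.
move=> MQ Da a0; apply: contrapT => none.
have neq1 Q' : M Q' -> ~ Q' (1 : D)%:F.
  by move=> MQ'; rewrite tofrac1; exact: (quasi_maximal_not1 MQ').
pose C := [set x | forall Q', M Q' -> Q' <> Q ->
  exists s d : D, ~ Q' s%:F /\ s%:F * x = d%:F * a] `&` domain D.
have Ca : C a by split=> // Q' MQ' _; exists 1, 1; split=> //; exact: neq1.
have nC : nonzero_ideal C.
  split; last by move=> x [].
  split; last by exists a.
  apply: submodule_setI; last exact: submodule_domain.
  split=> [Q' MQ' _|x y Cx Cy Q' MQ' Q'Q|e x Cx Q' MQ' Q'Q].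
  - by exists 1, 0; split; [exact: neq1|rewrite tofrac0; ring].
  - have [s [d [Qs sx]]] := Cx Q' MQ' Q'Q; have [t [e [Qt ty]]] := Cy Q' MQ' Q'Q.
    exists (s * t), (t * d + s * e); split; first exact: (quasi_maximal_prime MQ' Qs Qt).
    rewrite tofracD !tofracM [RHS]mulrDl -![_ * _ * a]mulrA -sx -ty; ring.
  - have [s [d [Qs sx]]] := Cx Q' MQ' Q'Q; exists s, (e * d); split=> //.
    by rewrite tofracM mulrCA sx mulrA.
have CQ : C `<=` Q.
  move=> x [Cx [t _ tx]]; apply: contrapT => Qx; apply: none.
  by exists t; rewrite tx.
have [c Cc cP] := dedekind_local_principal nC MQ.
have nQ := quasi_maximal_ideal MQ.
have [J [nJ fJ JQ QJ]] := dedekind_at_loc_fg nQ.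
have [e [z [u [Je Jz ez Qu]]]] := prufer_local_inverse MQ nJ fJ.
have c0 : c != 0.
  apply/eqP => c0; have [s [d [Qs]]] := cP a Ca; rewrite c0 mulr0 => /eqP.
  rewrite mulf_eq0 (negPf a0) orbF => /eqP s0; apply: Qs; rewrite s0.
  by case: nQ => -[[]].
have [s Qs Jsc] := QJ Q MQ c (CQ c Cc).
(* At [Q'] different from [Q], some [y] in [Q] is outside [Q']; as [z] maps [r y] into [D], it lies
   in [D_Q'], so multiplication by [z] stays in [a D_Q']. *)
have Cw : C (z * (s%:F * c)).
  split; last exact: inverse_mul Jsc Jz.
  move=> Q' MQ' Q'Q.
  have [y Qy Q'y] : exists2 y, Q y & ~ Q' y.
    apply: contrapT => noy; apply: Q'Q; apply: (quasi_maximal_incomparable MQ MQ').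
    by move=> y Qy; apply: contrapT => Q'y; apply: noy; exists y.
  have [y' _ y'E] := proj2 nQ y Qy; rewrite -y'E in Qy Q'y.
  have [r Q'r Jry] := QJ Q' MQ' _ Qy.
  have [p _ pE] := inverse_mul Jry Jz.
  have [v [d [Q'v vc]]] := proj1 Cc Q' MQ' Q'Q.
  exists (v * (r * y')), (s * p * d); split.
    exact: (quasi_maximal_prime MQ' Q'v (quasi_maximal_prime MQ' Q'r Q'y)).
  rewrite !tofracM -[RHS]mulrA -vc pE; ring.
(* Cancelling [c] gives [v s z = d]; multiplying by [e] gives [v s u = d e] in [Q], against
   primeness. *)
have [v [d [Qv vw]]] := cP _ Cw.
have vz : (v * s)%:F * z = d%:F.
  by apply: (mulIf c0); rewrite -vw tofracM; ring.
apply: (quasi_maximal_prime MQ (quasi_maximal_prime MQ Qv Qs) Qu).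
have -> : (v * s * u)%:F = d%:F * e by rewrite tofracM -ez -vz; ring.
by case: nQ => -[[_ _ QZ] _] _; apply: QZ; exact: JQ.
Qed.

Lemma dedekind_two_generated : two_generated star.
Proof.
move=> I nI a Ia a0; have [[sI _] ID] := nI.
(* This is the trace on [D] of the [tilde]-closure of [(a,b)D], unfolded by [tildeP]. *)
pose T b := [set x | forall Q, M Q -> at_loc Q (generated [:: a; b]) x] `&` domain D.
have sG b : submodule (generated [:: a; b]) by exact: submodule_generated.
have aG b : generated [:: a; b] a by apply: mem_generated; rewrite inE eqxx.
have bG b : generated [:: a; b] b by apply: mem_generated; rewrite !inE eqxx orbT.
have GI b : I b -> generated [:: a; b] `<=` I.
  by move=> Ib; apply: generated_sub => // x; rewrite !inE => /orP[]/eqP->.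
have GT b : I b -> generated [:: a; b] `<=` T b.
  by move=> Ib x Gx; split; [move=> Q MQ; exact: (at_loc_sub MQ)|apply: ID; exact: GI Gx].
have qT b : I b -> quasi_ideal star (T b).
  move=> Ib; apply: locally_closed_quasi_ideal.
    split; last by move=> x [].
    split; last by exists a => //; exact: GT.
    apply: submodule_setI; last exact: submodule_domain.
    split=> [Q MQ|x y Tx Ty Q MQ|d x Tx Q MQ];
      have [L0 LD LZ] := submodule_at_loc MQ (sG b) => //.
      by apply: LD; [exact: Tx|exact: Ty].
    by apply: LZ; exact: Tx.
  move=> x Dx Tx; split=> // Q MQ; apply: (at_loc_idem MQ).
  by apply: at_loc_mono (Tx Q MQ) => y [Ty _]; exact: Ty.
have [||_ [b Ib <-] Tmax] := @star_noetherian_maximal [set T b | b in I].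
- by exists (T a), a.
- by move=> _ [b Ib <-]; exact: qT.
suff loc Q : M Q -> I `<=` at_loc Q (generated [:: a; b]).
  exists b; split; first exact: (sub_tilde sI).
  rewrite eqEsubset; split=> x.
    move=> /(tildeP sI) xP; apply/tildeP => // Q MQ.
    by apply: (at_loc_idem MQ); apply: at_loc_mono (xP Q MQ); exact: loc.
  move=> /(tildeP (sG b)) xP; apply/tildeP => // Q MQ.
  by apply: at_loc_mono (xP Q MQ); exact: GI.
move=> MQ; have [c Ic cP] := dedekind_local_principal nI MQ.
set G := generated [:: a; b].
have locG : submodule (at_loc Q G) by exact: (submodule_at_loc MQ (sG b)).
suff Gc : at_loc Q G c.
  move=> x /cP[s [d [Qs sx]]]; apply: (at_loc_idem MQ); exists s => //.
  by rewrite sx; case: locG => _ _; apply.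
apply: contrapT => Gc.
(* Since [c] is not in [G D_Q], the elements of [G] are multiples of [c] at [Q] with coefficients in
   [Q] only. *)
have divQ y s d : G y -> ~ Q s%:F -> s%:F * y = d%:F * c -> Q d%:F.
  move=> Gy Qs sy; apply: contrapT => Qd; apply: Gc; exists d => //.
  by rewrite -sy; case: (sG b) => _ _; apply.
have [t Qt tP] := dedekind_separate MQ (ID _ Ia) a0.
pose b' := b + t%:F * c.
have Ib' : I b' by case: sI => _ IA IZ; apply: IA => //; exact: IZ.
have sG' := sG b'; have [_ GA' GZ'] := sG'.
have bT Q' : M Q' -> at_loc Q' (generated [:: a; b']) b.
  move=> MQ'; have [->|Q'Q] := pselect (Q' = Q).
    (* At [Q], [s b = d c] gives [s b' = (s t + d) c], where [d] is in [Q] and [s t] is not. So [b']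
       generates [c], and with it [b]. *)
    have [s [d [Qs sb]]] := cP b Ib; have Qd := divQ _ _ _ (bG b) Qs sb.
    have Qstd : ~ Q (s * t + d)%:F.
      move=> Qstd; apply: (quasi_maximal_prime MQ Qs Qt).
      have [[[_ QA QZ] _] _] := quasi_maximal_ideal MQ.
      have -> : (s * t)%:F = (s * t + d)%:F + (-1 : D)%:F * d%:F.
        by rewrite tofracD tofracN tofrac1; ring.
      by apply: QA => //; exact: QZ.
    exists ((s * t + d) * s); first exact: (quasi_maximal_prime MQ Qstd Qs).
    have -> : ((s * t + d) * s)%:F * b = d%:F * (s%:F * b').
      rewrite /b' tofracM -mulrA sb mulrDr sb tofracD tofracM; ring.
    by do 2!apply: (GZ'); exact: bG.
  (* Away from [Q], [s t = d a] makes [s t c] a multiple of [a], so [b] and [b'] agree modulo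
     [a]. *)
  have [s [d [Qs st]]] := tP Q' MQ' Q'Q; exists s => //.
  have [c' _ c'E] := ID c Ic.
  have -> : s%:F * b = s%:F * b' + (- (d * c'))%:F * a.
    rewrite /b' tofracN tofracM c'E mulrDr mulrA st; ring.
  by apply: GA'; apply: GZ'; [exact: bG|exact: aG].
have TT : T b' = T b.
  apply: Tmax; first by exists b'.
  move=> x [Tx Dx]; split=> // Q' MQ'; apply: (at_loc_idem MQ').
  apply: at_loc_mono (Tx Q' MQ'); apply: generated_sub; first exact: (submodule_at_loc MQ').
  move=> y; rewrite !inE => /orP[]/eqP->; first exact: (at_loc_sub MQ').
  exact: bT.
(* By maximality [b'] is in [G D_Q], hence so is [t c = b' - b]; as [t] is outside [Q], so is [c], a
   contradiction. *)
have [Gb' _] : T b b' by rewrite -TT; apply: GT.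
apply: Gc; apply: (at_loc_idem MQ); exists t => //.
have -> : t%:F * c = b' + (-1 : D)%:F * b by rewrite /b' tofracN tofrac1; ring.
have [_ LA LZ] := locG; apply: LA; first exact: Gb'.
by apply: LZ; apply: (at_loc_sub MQ); exact: bG.
Qed.

End Dedekind_implies_two_generators.

Theorem theorem4p27 (D : idomainType) (hD : ~ GRing.field_axiom D)
    (star : semistar D) :
  star_dedekind star <->
  (forall I : set {fraction D}, nonzero_ideal I ->
   forall a : {fraction D}, I a -> a != 0 ->
   exists b : {fraction D}, tilde star I b /\
     tilde star I = tilde star (generated [:: a; b])).
Proof.
split=> [[noeth prufer]|gen2]; first exact: dedekind_two_generated.
by split; [exact: two_generated_noetherian|exact: two_generated_prufer].
Qed.
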